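(* Let $a,b,c\in\mathbb C$ with $c\notin\mathbb Z$. Then, as power series in $t$, $$F(a,b,c;t)F(-a,-b-2,-c;t)+\frac{ab}{c(c-1)}\,t\,F(a+1,b+1,c+1;t)F(-a,-b-2,-c;t)$$ $$+\frac{a\,(b)_3\,(a-c)_2}{(c-2)_3\,(c-1)_3}\,t^3\,F(a-c+2,b-c+2,3-c;t)F(-a+c+1,-b+c-1,2+c;t)$$ $$=1+\frac{a(b-2c+2)}{c(c-1)}\,t+\frac{a(a-b-1)}{c(c-1)}\,t^2 .$$
   Context: $F(a,b,c;t)={}_2F_1(a,b,c;t)=\sum_{n\ge0}\frac{(a)_n(b)_n}{n!\,(c)_n}t^n$ is the Gauss hypergeometric series, with $(a)_n=a(a+1)\cdots(a+n-1)$. *)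

(* Defs.v *)
From HB Require Import structures.
From mathcomp Require Import all_boot all_order all_algebra.
From mathcomp Require Export complex.
From mathcomp Require Import boolp.
From mathcomp Require Export reals.

Set Implicit Arguments.
Unset Strict Implicit.
Unset Printing Implicit Defensive.

Import GRing.Theory.
Local Open Scope ring_scope.

(* Formal power series over a commutative ring K: [fcoef f n] is the
   coefficient of t^n. The product is the Cauchy product. *)

Record fps (K : Type) := FPS { fcoef : nat -> K }.

Lemma fpsP (K : Type) (f g : fps K) : (forall n, fcoef f n = fcoef g n) <-> f = g.
Proof.
split=> [|-> //]; case: f => f; case: g => g /= fg.
by congr FPS; apply/funext.
Qed.

HB.instance Definition _ (K : Type) := gen_eqMixin (fps K).
HB.instance Definition _ (K : Type) := gen_choiceMixin (fps K).

Section FpsZmodule.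
Variable K : zmodType.
Implicit Types f g h : fps K.

Definition fps_zero : fps K := FPS (fun=> 0).
Definition fps_opp f : fps K := FPS (fun n => - fcoef f n).
Definition fps_add f g : fps K := FPS (fun n => fcoef f n + fcoef g n).

Fact fps_addA : associative fps_add.
Proof. by move=> f g h; apply/fpsP => n /=; rewrite addrA. Qed.
Fact fps_addC : commutative fps_add.
Proof. by move=> f g; apply/fpsP => n /=; rewrite addrC. Qed.
Fact fps_add0 : left_id fps_zero fps_add.
Proof. by move=> f; apply/fpsP => n /=; rewrite add0r. Qed.
Fact fps_addN : left_inverse fps_zero fps_opp fps_add.
Proof. by move=> f; apply/fpsP => n /=; rewrite addNr. Qed.

HB.instance Definition _ :=
  Algebra.isZmodule.Build (fps K) fps_addA fps_addC fps_add0 fps_addN.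
End FpsZmodule.

Section FpsRing.
Variable K : comNzRingType.
Implicit Types f g h : fps K.

Definition fps_one : fps K := FPS (fun n => (n == 0%N)%:R).
Definition fps_mul f g : fps K :=
  FPS (fun n => \sum_(i < n.+1) fcoef f i * fcoef g (n - i)).
Definition fps_scale (k : K) f : fps K := FPS (fun n => k * fcoef f n).

Definition fps_trunc N f : {poly K} := \poly_(i < N) fcoef f i.

Fact fps_mul_trunc N n f g : (n < N)%N ->
  fcoef (fps_mul f g) n = (fps_trunc N f * fps_trunc N g)`_n.
Proof.
move=> ltnN; rewrite coefM; apply: eq_bigr => i _; rewrite !coef_poly.
by rewrite (leq_ltn_trans (leq_subr _ _) ltnN) (leq_ltn_trans _ ltnN) // -ltnS.
Qed.

Fact fps_mulC : commutative fps_mul.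
Proof. by move=> f g; apply/fpsP => n; rewrite !(fps_mul_trunc _ _ (ltnSn n)) mulrC. Qed.

Fact fps_mulA : associative fps_mul.
Proof.
move=> f g h; apply/fpsP => n.
pose T := fps_trunc n.+1.
have -> : fcoef (fps_mul f (fps_mul g h)) n = (T f * (T g * T h))`_n.
  rewrite coefM /=; apply: eq_bigr => i _.
  rewrite coef_poly ltn_ord; congr (_ * _).
  exact: (@fps_mul_trunc n.+1 (n - i) g h (leq_subr i n)).
rewrite mulrA coefM /=; apply: eq_bigr => i _.
rewrite (coef_poly _ _ (n - i)) ltnS leq_subr; congr (_ * _).
exact: (esym (@fps_mul_trunc n.+1 i f g (ltn_ord i))).
Qed.

Fact fps_mul1 : left_id fps_one fps_mul.
Proof.
move=> f; apply/fpsP => n /=; rewrite big_ord_recl /= mul1r subn0 big1 ?addr0 //.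
by move=> i _; rewrite mul0r.
Qed.

Fact fps_mulD : left_distributive fps_mul +%R.
Proof.
move=> f g h; apply/fpsP => n /=; rewrite -big_split /=.
by apply: eq_bigr => i _; rewrite mulrDl.
Qed.

Fact fps_one_neq0 : fps_one != 0.
Proof. by apply/eqP => /fpsP /(_ 0%N) /= /eqP; rewrite oner_eq0. Qed.

HB.instance Definition _ := GRing.Zmodule_isComNzRing.Build (fps K)
  fps_mulA fps_mulC fps_mul1 fps_mulD fps_one_neq0.

Fact fps_scaleA a b f : fps_scale a (fps_scale b f) = fps_scale (a * b) f.
Proof. by apply/fpsP => n /=; rewrite mulrA. Qed.
Fact fps_scale1 : left_id 1 fps_scale.
Proof. by move=> f; apply/fpsP => n /=; rewrite mul1r. Qed.
Fact fps_scaleDr : right_distributive fps_scale +%R.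
Proof. by move=> a f g; apply/fpsP => n /=; rewrite mulrDr. Qed.
Fact fps_scaleDl f : {morph fps_scale^~ f : a b / a + b}.
Proof. by move=> a b; apply/fpsP => n /=; rewrite mulrDl. Qed.

HB.instance Definition _ := GRing.Zmodule_isLmodule.Build K (fps K)
  fps_scaleA fps_scale1 fps_scaleDr fps_scaleDl.

Fact fps_scaleAl (a : K) f g : a *: (f * g) = (a *: f) * g.
Proof.
by apply/fpsP => n /=; rewrite mulr_sumr; apply: eq_bigr => i _; rewrite mulrA.
Qed.

HB.instance Definition _ := GRing.Lmodule_isLalgebra.Build K (fps K) fps_scaleAl.
HB.instance Definition _ := GRing.Lalgebra_isComAlgebra.Build K (fps K).

(* The indeterminate t. *)
Definition fpsX : fps K := FPS (fun n => (n == 1%N)%:R).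

End FpsRing.
Arguments fpsX {K}.

(* The Pochhammer symbol (x)_n = x (x + 1) ... (x + n - 1). *)
Definition poch (K : nzRingType) (x : K) (n : nat) : K := \prod_(i < n) (x + i%:R).

(* Only meaningful when c is not a nonpositive integer, since 0^-1 = 0. *)
Definition hyp2F1 (K : fieldType) (a b c : K) : fps K :=
  FPS (fun n => poch a n * poch b n / (n`!%:R * poch c n)).

(* Main.v *)
Require Import Defs.
From HB Require Import structures.
From mathcomp Require Import all_boot all_order all_algebra.
From mathcomp Require Import ring.

Set Implicit Arguments.
Unset Strict Implicit.
Unset Printing Implicit Defensive.

Import GRing.Theory Num.Theory.
Local Open Scope ring_scope.

(** Put [e = c - 1]. Since [(theta + e) F(a,b,e+1) = e F(a,b,e)], where
[theta = t d/dt], the first two terms of the identity add up to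
[F(a,b,e) F(-a,-b-2,-e-1)] ([hyp2F1_contig]), so the left-hand side becomes
[S1 = w1 y1 z1 + w2 y2 z2] with [w1 = 1], [w2 = k t^3]. Here [y1] and
[t^(1-e) y2] are the two local solutions at 0 of the hypergeometric equation
with parameters [(a, b, e)], while [z1] and [t^(e+2) z2] are those for
[(-a, -b-2, -e-1)], and the weight [t^3] is the product of the two powers.

The two equations are, up to an integral shift of the parameters, dual to each
other, and for the right value of [k] the sum [S1] is the invariant pairing of
their solution spaces. It is therefore single-valued, and the local exponents
allow no pole at 0 or 1 and a growth of at most [t^2] at infinity: this is why
it is a polynomial of degree at most 2.

The proof uses only power series. The four products of [y, theta y] with
[z, theta z], summed over both solutions, satisfy a first-order linear system
over the polynomials ([bilinear_system_sol], [bilinear_systemD]). The fractional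
powers of [t] never appear: they are absorbed into the twisted derivations
[theta + s]. Read on coefficients, the system is a recurrence which determines
the coefficients of index [n] from those of index [n - 1], except at the
exponents 0 and 3 of the system; the other two exponents, [1 - e] and [e + 2],
are not integers. The coefficient of index 3 of the last component is thus the
one extra datum, and the value of [k] is the one for which the recurrence
breaks off ([bilinear_system_quadratic], [hyp2F1_bilinear]). *)

(** * Formal power series and the Euler derivation *)

Section FpsTheory.
Variable K : comNzRingType.
Implicit Types (f g h w : fps K) (k s r : K).

(** Constants as a ring morphism, so that scalings can be turned into products
and identities mixing both be decided by [ring]. *)
Definition fpsC k : fps K := k *: 1.

HB.instance Definition _ := GRing.RMorphism.copy fpsC (GRing.in_alg (fps K)).

Lemma fpsCE k f : k *: f = fpsC k * f.
Proof. by rewrite /fpsC mulr_algl. Qed.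

Lemma fcoefD f g n : fcoef (f + g) n = fcoef f n + fcoef g n.
Proof. by []. Qed.

Lemma fcoefB f g n : fcoef (f - g) n = fcoef f n - fcoef g n.
Proof. by []. Qed.

Lemma fcoefZ k f n : fcoef (k *: f) n = k * fcoef f n.
Proof. by []. Qed.

Lemma fcoefM f g n :
  fcoef (f * g) n = \sum_(i < n.+1) fcoef f i * fcoef g (n - i).
Proof. by []. Qed.

Lemma fcoefM0 f g : fcoef (f * g) 0 = fcoef f 0 * fcoef g 0.
Proof. by rewrite fcoefM big_ord1. Qed.

Lemma fcoefM2 f g : fcoef f 0 = 0 -> fcoef g 0 = 0 ->
  fcoef (f * g) 2 = fcoef f 1 * fcoef g 1.
Proof.
move=> f0 g0; rewrite fcoefM !big_ord_recr big_ord0 /=.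
by rewrite f0 g0 mul0r mulr0 addr0 !add0r.
Qed.

Lemma fcoefM3 f g : fcoef f 0 = 0 -> fcoef g 0 = 0 ->
  fcoef (f * g) 3 = fcoef f 1 * fcoef g 2 + fcoef f 2 * fcoef g 1.
Proof.
move=> f0 g0; rewrite fcoefM !big_ord_recr big_ord0 /=.
by rewrite f0 g0 mul0r mulr0 addr0 !add0r.
Qed.

Lemma fcoefXM0 f : fcoef (fpsX * f) 0 = 0.
Proof. by rewrite fcoefM0 mul0r. Qed.

Lemma fcoefXMS f n : fcoef (fpsX * f) n.+1 = fcoef f n.
Proof.
rewrite fcoefM 2!big_ord_recl big1 => [|i _]; last by rewrite mul0r.
by rewrite /= mul0r mul1r add0r addr0 subn1.
Qed.

Lemma fcoefXnM m f n :
  fcoef (fpsX ^+ m * f) n = if (n < m)%N then 0 else fcoef f (n - m).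
Proof.
elim: m n => [|m IHm] [|n]; rewrite ?mul1r // exprS -mulrA.
  by rewrite fcoefXM0.
by rewrite fcoefXMS IHm ltnS subSS.
Qed.

Lemma fcoef1BXMS f n :
  fcoef ((1 - fpsX) * f) n.+1 = fcoef f n.+1 - fcoef f n.
Proof. by rewrite mulrBl mul1r fcoefB fcoefXMS. Qed.

Definition theta f : fps K := FPS (fun n => n%:R * fcoef f n).

Lemma fcoef_theta f n : fcoef (theta f) n = n%:R * fcoef f n.
Proof. by []. Qed.

Lemma thetaD f g : theta (f + g) = theta f + theta g.
Proof. by apply/fpsP => n /=; rewrite mulrDr. Qed.

Lemma thetaB f g : theta (f - g) = theta f - theta g.
Proof. by apply/fpsP => n /=; rewrite mulrBr. Qed.

Lemma thetaZ k f : theta (k *: f) = k *: theta f.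
Proof. by apply/fpsP => n /=; rewrite mulrCA. Qed.

Lemma thetaM f g : theta (f * g) = theta f * g + f * theta g.
Proof.
apply/fpsP => n; rewrite fcoefD fcoef_theta !fcoefM mulr_sumr -big_split /=.
apply: eq_bigr => i _; rewrite /=.
have -> : n%:R = i%:R + (n - i)%:R :> K by rewrite -natrD subnKC // -ltnS.
ring.
Qed.

Lemma theta1 : theta 1 = 0.
Proof. by apply/fpsP => -[|n]; rewrite fcoef_theta ?mul0r ?mulr0. Qed.

Lemma thetaX : theta fpsX = fpsX.
Proof. by apply/fpsP => -[|[|n]] /=; rewrite ?mul0r ?mulr0 ?mulr1. Qed.

Lemma thetaXn n : theta (fpsX ^+ n) = n%:R *: fpsX ^+ n.
Proof.
elim: n => [|n IHn]; first by rewrite expr0 theta1 scale0r.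
rewrite exprS thetaM thetaX IHn -natr1 scalerDl scale1r.
by rewrite scalerAr addrC.
Qed.

(** Conjugation of [theta] by [t^s]: formally
[t^s * twist s f = theta (t^s * f)], for an arbitrary scalar [s]. *)
Definition twist s f : fps K := theta f + s *: f.

Lemma fcoef_twist s f n : fcoef (twist s f) n = (n%:R + s) * fcoef f n.
Proof. by rewrite /twist fcoefD fcoefZ fcoef_theta mulrDl. Qed.

(** The hypothesis says that [w] behaves as [t^(s+r)], so that [w * f * g]
stands for the product of [t^s f] and [t^r g]. *)
Lemma theta_twistM s r w f g : theta w = (s + r) *: w ->
  theta (w * f * g) = w * twist s f * g + w * f * twist r g.
Proof.
move=> w_exp; rewrite !thetaM w_exp /twist !fpsCE; ring.
Qed.

End FpsTheory.

Lemma eq_from_sub (V : zmodType) (u v x y : V) :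
  u = v -> x - y = u - v -> x = y.
Proof. by move=> -> /eqP; rewrite subrr subr_eq0 => /eqP. Qed.

(** * The linear system satisfied by products of solutions *)

Section BilinearSystem.
Variable K : comNzRingType.
Implicit Types (a b c s r : K) (y z w : fps K).

(** [t^s * y] formally solves the hypergeometric equation with parameters
[a], [b], [c], written
[(1 - t) theta^2 = (1 - c) theta + t ((a + b) theta + a b)]. *)
Definition hyp_sol s a b c y :=
  (1 - fpsX) * twist s (twist s y)
  = (1 - c) *: twist s y
    + fpsX * ((a + b) *: twist s y + (a * b) *: y).

(** The system for [S1 = Y Z], [S2 = (theta Y) Z], [S3 = Y (theta Z)] and
[T = (1 - t) (theta Y) (theta Z)], when [Y] solves the equation with parameters
[(a, b, c)] and [Z] the one with [(-a, -b - 2, -c - 1)]. The factor [1 - t] in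
[T] clears the simple pole at 1 which [(theta Y) (theta Z)] acquires in the
invariant pairing. *)
Definition bilinear_system a b c (S1 S2 S3 T : fps K) := [/\
  theta S1 = S2 + S3,
  (1 - fpsX) * theta S2
    = (1 - c) *: S2 + fpsX * ((a + b) *: S2 + (a * b) *: S1) + T,
  (1 - fpsX) * theta S3
    = (c + 2) *: S3 + fpsX * (a * (b + 2) *: S1 - (a + b + 2) *: S3) + T &
  theta T = 3 *: T + fpsX * ((a * b) *: S3 + a * (b + 2) *: S2)].

Lemma bilinear_system_sol a b c s r w y z :
    hyp_sol s a b c y -> hyp_sol r (- a) (- b - 2) (- c - 1) z ->
    theta w = (s + r) *: w ->
  bilinear_system a b c (w * y * z) (w * twist s y * z) (w * y * twist r z)
    ((1 - fpsX) * (w * twist s y * twist r z)).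
Proof.
rewrite /hyp_sol => y_sol z_sol w_exp; rewrite /bilinear_system.
rewrite [theta ((1 - fpsX) * _)]thetaM thetaB theta1 thetaX.
rewrite !(theta_twistM _ _ w_exp).
set y1 := twist s y in y_sol *; set y2 := twist s y1 in y_sol *.
set z1 := twist r z in z_sol *; set z2 := twist r z1 in z_sol *.
have yE u : (1 - fpsX) * (w * y2 * u) = w * u * ((1 - fpsX) * y2) by ring.
have zE u : (1 - fpsX) * (w * u * z2) = w * u * ((1 - fpsX) * z2) by ring.
by split; rewrite ?[(1 - fpsX) * (_ + _)]mulrDr ?yE ?zE ?y_sol ?z_sol // !fpsCE;
  ring.
Qed.

Lemma bilinear_systemD a b c S1 S2 S3 T S1' S2' S3' T' :
    bilinear_system a b c S1 S2 S3 T -> bilinear_system a b c S1' S2' S3' T' ->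
  bilinear_system a b c (S1 + S1') (S2 + S2') (S3 + S3') (T + T').
Proof.
move=> [H1 H2 H3 H4] [H1' H2' H3' H4'].
by split; rewrite thetaD ?[(1 - fpsX) * (_ + _)]mulrDr ?H1 ?H2 ?H3 ?H4 ?H1' ?H2'
  ?H3' ?H4' ?fpsCE; ring.
Qed.

End BilinearSystem.

(** * Polynomial solutions of the system *)

Section Recurrence.
Variable K : numFieldType.
Implicit Types (a b c : K).

(** Beyond the constant terms, only the coefficient of [t^3] in [T] is free, as
3 is the other integral exponent of the system at 0. The prescribed value is
the one that makes the coefficients of [t^3] in [S2] and [S3] vanish, after
which the recurrence yields 0 forever. *)
Lemma bilinear_system_quadratic a b c (S1 S2 S3 T : fps K) :
    (forall m : int, c <> m%:~R) -> bilinear_system a b c S1 S2 S3 T ->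
    fcoef S1 0 = 1 -> fcoef S2 0 = 0 -> fcoef S3 0 = 0 ->
    fcoef T 3 = a * b * (b + 2) * (a - b - 1) / (c * (c + 1)) ->
  S1 = 1 + (a * (b - 2 * c) / (c * (c + 1))) *: fpsX
         + (a * (a - b - 1) / (c * (c + 1))) *: fpsX ^+ 2.
Proof.
move=> cNint [H1 H2 H3 H4] S10 S20 S30 T3.
have cn0 (m : int) : c + m%:~R != 0.
  by apply/eqP => /eqP; rewrite addr_eq0 -mulrNz => /eqP/cNint.
have c0 : c != 0 by have := cn0 0; rewrite addr0.
have c1 : c + 1 != 0 by have := cn0 1.
have c2 : c + 2 != 0 by have := cn0 2.
have r1 n : n%:R * fcoef S1 n = fcoef S2 n + fcoef S3 n.
  by rewrite -fcoef_theta H1.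
have r2 n : (n%:R + c) * fcoef S2 n.+1
    = (n%:R + a + b) * fcoef S2 n + a * b * fcoef S1 n + fcoef T n.+1.
  move/fpsP/(_ n.+1): H2; rewrite mulrBl mul1r fcoefB !fcoefD !fcoefXMS.
  rewrite !fcoefD !fcoefZ !fcoef_theta -natr1 => E.
  apply: (eq_from_sub E); ring.
have r3 n : (n%:R - c - 1) * fcoef S3 n.+1
    = (n%:R - a - b - 2) * fcoef S3 n + a * (b + 2) * fcoef S1 n
      + fcoef T n.+1.
  move/fpsP/(_ n.+1): H3; rewrite mulrBl mul1r fcoefB !fcoefD !fcoefXMS.
  rewrite fcoefB !fcoefZ !fcoef_theta -natr1 => E.
  apply: (eq_from_sub E); ring.
have r4 n : (n%:R - 2) * fcoef T n.+1
    = a * b * fcoef S3 n + a * (b + 2) * fcoef S2 n.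
  move/fpsP/(_ n.+1): H4; rewrite !fcoefD !fcoefXMS.
  rewrite !fcoefD !fcoefZ !fcoef_theta -natr1 => E.
  apply: (eq_from_sub E); ring.
have dS2 (n : nat) (x : K) :
    (n%:R + a + b) * fcoef S2 n + a * b * fcoef S1 n + fcoef T n.+1
    = (n%:R + c) * x -> fcoef S2 n.+1 = x.
  rewrite -r2; apply: mulfI.
  by have := cn0 n; rewrite addrC.
have dS3 (n : nat) (x : K) :
    (n%:R - a - b - 2) * fcoef S3 n + a * (b + 2) * fcoef S1 n + fcoef T n.+1
    = (n%:R - c - 1) * x -> fcoef S3 n.+1 = x.
  rewrite -r3; apply: mulfI.
  have -> : n%:R - c - 1 = - (c + (1 - n%:Z)%:~R) by rewrite rmorphB /=; ring.
  by rewrite oppr_eq0.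
have dS1 (n : nat) (x : K) :
    fcoef S2 n.+1 + fcoef S3 n.+1 = n.+1%:R * x -> fcoef S1 n.+1 = x.
  by rewrite -r1; apply: mulfI; rewrite pnatr_eq0.
have dT (n : nat) (x : K) : n != 2 ->
    a * b * fcoef S3 n + a * (b + 2) * fcoef S2 n = (n%:R - 2) * x ->
  fcoef T n.+1 = x.
  rewrite -r4 => n2; apply: mulfI.
  by rewrite subr_eq0 eqr_nat.
have T1 : fcoef T 1 = 0 by apply: dT => //; rewrite S30 S20; ring.
have S21 : fcoef S2 1 = a * b / c by apply: dS2; rewrite S20 S10 T1; field.
have S31 : fcoef S3 1 = - (a * (b + 2)) / (c + 1).
  by apply: dS3; rewrite S30 S10 T1; field.
have S11 : fcoef S1 1 = a * (b - 2 * c) / (c * (c + 1)).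
  by apply: dS1; rewrite S21 S31; field; rewrite ?c0 ?c1.
have T2 : fcoef T 2 = - (a ^+ 2 * b * (b + 2)) / (c * (c + 1)).
  by apply: dT => //; rewrite S31 S21; field; rewrite ?c0 ?c1.
have S22 : fcoef S2 2 = a * b * (1 + b - a) / (c * (c + 1)).
  by apply: dS2; rewrite S21 S11 T2; field; rewrite ?c0 ?c1.
have S32 : fcoef S3 2 = a * (b + 2) * (a - b - 1) / (c * (c + 1)).
  by apply: dS3; rewrite S31 S11 T2; field; rewrite ?c0 ?c1.
have S12 : fcoef S1 2 = a * (a - b - 1) / (c * (c + 1)).
  by apply: dS1; rewrite S22 S32; field; rewrite ?c0 ?c1.
have tail n : [/\ fcoef S1 n.+3 = 0, fcoef S2 n.+3 = 0 & fcoef S3 n.+3 = 0].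
  have S1tail m : fcoef S2 m.+3 = 0 -> fcoef S3 m.+3 = 0 -> fcoef S1 m.+3 = 0.
    by move=> z2 z3; apply: dS1; rewrite z2 z3; ring.
  elim: n => [|n [z1 z2 z3]].
    have z2 : fcoef S2 3 = 0.
      by apply: dS2; rewrite S22 S12 T3; field; rewrite ?c0 ?c1.
    have z3 : fcoef S3 3 = 0.
      by apply: dS3; rewrite S32 S12 T3; field; rewrite ?c0 ?c1.
    by split=> //; apply: S1tail.
  have zT : fcoef T n.+4 = 0 by apply: dT => //; rewrite z2 z3; ring.
  have z2' : fcoef S2 n.+4 = 0 by apply: dS2; rewrite z1 z2 zT; ring.
  have z3' : fcoef S3 n.+4 = 0 by apply: dS3; rewrite z1 z3 zT; ring.
  by split=> //; apply: S1tail.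
apply/fpsP => n; rewrite !fcoefD !fcoefZ expr2.
case: n => [|[|[|n]]]; rewrite ?fcoefXM0 ?fcoefXMS /= ?S10 ?S11 ?S12;
  rewrite ?mulr0 ?mulr1 ?addr0 ?add0r //.
by have [-> _ _] := tail n.
Qed.

End Recurrence.

(** * Hypergeometric series *)

Section Hypergeometric.
Variable K : numFieldType.
Implicit Types (a b c s : K).

Lemma poch0 a : poch a 0 = 1.
Proof. exact: big_ord0. Qed.

Lemma pochSr a n : poch a n.+1 = poch a n * (a + n%:R).
Proof. exact: big_ord_recr. Qed.

Lemma pochSl a n : poch a n.+1 = a * poch (a + 1) n.
Proof.
rewrite /poch big_ord_recl addr0; congr (_ * _).
by apply: eq_bigr => i _; rewrite -addrA nat1r.
Qed.

Lemma poch_neq0 c n : (forall m : nat, c + m%:R != 0) -> poch c n != 0.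
Proof. by move=> c_neq0; apply/prodf_neq0 => i _. Qed.

Lemma hyp2F1_0 a b c : fcoef (hyp2F1 a b c) 0 = 1.
Proof. by rewrite /= !poch0 !mulr1 divr1. Qed.

Lemma hyp2F1_1 a b c : fcoef (hyp2F1 a b c) 1 = a * b / c.
Proof. by rewrite /= !pochSr !poch0 !mul1r !addr0. Qed.

Lemma hyp2F1_2 a b c :
  fcoef (hyp2F1 a b c) 2
  = a * (a + 1) * (b * (b + 1)) / (2 * (c * (c + 1))).
Proof. by rewrite /= !pochSr !poch0 !mul1r !addr0. Qed.

Lemma hyp2F1S a b c n : (forall m : nat, c + m%:R != 0) ->
  n.+1%:R * (c + n%:R) * fcoef (hyp2F1 a b c) n.+1
  = (a + n%:R) * (b + n%:R) * fcoef (hyp2F1 a b c) n.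
Proof.
move=> c_neq0; rewrite /= !pochSr factS natrM.
by field; rewrite nat1r !pnatr_eq0 -lt0n fact_gt0 c_neq0 poch_neq0.
Qed.

(** The left-hand side is [(theta + c - 1) F(a,b,c)] divided by [c - 1], the
operator that lowers [c]. *)
Lemma hyp2F1_contig a b c : (forall m : nat, c - 1 + m%:R != 0) ->
  hyp2F1 a b c
  + (a * b / (c * (c - 1))) *: (fpsX * hyp2F1 (a + 1) (b + 1) (c + 1))
  = hyp2F1 a b (c - 1).
Proof.
move=> c1_neq0.
have c_neq0 m : c + m%:R != 0.
  by have := c1_neq0 m.+1; rewrite -natr1 [m%:R + 1]addrC addrA subrK.
apply/fpsP => -[|n]; rewrite fcoefD fcoefZ.
  by rewrite fcoefXM0 mulr0 addr0 !hyp2F1_0.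
rewrite fcoefXMS /= (pochSl (c - 1)) subrK (pochSr c) (pochSl a) (pochSl b).
have -> : poch (c + 1) n = poch c n * (c + n%:R) / c.
  rewrite -pochSr pochSl mulrAC divff ?mul1r //.
  by have := c_neq0 0; rewrite addr0.
rewrite factS natrM -natr1.
have := c1_neq0 0; have := c_neq0 0; rewrite !addr0 => c0 c1.
by field; rewrite natr1 !pnatr_eq0 -lt0n fact_gt0 c_neq0 poch_neq0 // c0 c1.
Qed.

(** The condition on [s] is the indicial equation at 0, with roots 0 and
[1 - c]. *)
Lemma hyp_sol_hyp2F1 s a b c :
    s * (s + c - 1) = 0 -> (forall m : nat, c + 2 * s + m%:R != 0) ->
  hyp_sol s a b c (hyp2F1 (a + s) (b + s) (c + 2 * s)).
Proof.
move=> s_exp c_neq0; apply/fpsP => n.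
rewrite mulrBl mul1r fcoefB !fcoef_twist [fcoef (_ + _) _]fcoefD fcoefZ.
rewrite fcoef_twist.
case: n => [|n].
  rewrite !fcoefXM0 hyp2F1_0; apply: (eq_from_sub s_exp); ring.
rewrite !fcoefXMS !fcoef_twist fcoefD !fcoefZ !fcoef_twist.
have := hyp2F1S (a + s) (b + s) n c_neq0; rewrite -natr1 => E.
set y' := fcoef _ n.+1 in E *; set y := fcoef _ n in E *.
(* Shifting by [s] changes the indicial polynomial by the vanishing [s_exp]. *)
have {}E : (n%:R + 1) * (c + 2 * s + n%:R) * y' + s * (s + c - 1) * y'
    = (a + s + n%:R) * (b + s + n%:R) * y
  by rewrite s_exp mul0r addr0.
apply: (eq_from_sub E); ring.
Qed.

(** The identity with the first two terms merged and [c] shifted by one. *)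
Lemma hyp2F1_bilinear a b c : (forall m : int, c <> m%:~R) ->
  hyp2F1 a b c * hyp2F1 (- a) (- b - 2) (- c - 1)
  + (a * poch b 3 * poch (a - c - 1) 2 / (poch (c - 1) 3 * poch c 3)) *:
      (fpsX ^+ 3 * hyp2F1 (a - c + 1) (b - c + 1) (2 - c)
                 * hyp2F1 (- a + c + 2) (- b + c) (3 + c))
  = 1 + (a * (b - 2 * c) / (c * (c + 1))) *: fpsX
      + (a * (a - b - 1) / (c * (c + 1))) *: fpsX ^+ 2.
Proof.
move=> cNint; set k := _ / _.
have cn0 (m : int) : c + m%:~R != 0.
  by apply/eqP => /eqP; rewrite addr_eq0 -mulrNz => /eqP/cNint.
have ncn0 (m : int) : m%:~R - c != 0.
  by rewrite -opprB oppr_eq0 -[- _%:~R]mulrNz.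
pose y1 := hyp2F1 a b c; pose z1 := hyp2F1 (- a) (- b - 2) (- c - 1).
pose y2 := hyp2F1 (a - c + 1) (b - c + 1) (2 - c).
pose z2 := hyp2F1 (- a + c + 2) (- b + c) (3 + c).
have y1_sol : hyp_sol 0 a b c y1.
  have := @hyp_sol_hyp2F1 0 a b c; rewrite !mulr0 !mul0r !addr0; apply=> // m.
  exact: (cn0 m).
have z1_sol : hyp_sol 0 (- a) (- b - 2) (- c - 1) z1.
  have := @hyp_sol_hyp2F1 0 (- a) (- b - 2) (- c - 1).
  rewrite !mulr0 !mul0r !addr0; apply=> // m.
  have -> : - c - 1 + m%:R = (m%:Z - 1)%:~R - c by rewrite rmorphB /=; ring.
  exact: ncn0.
have y2_sol : hyp_sol (1 - c) a b c y2.
  rewrite /y2.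
  have -> : a - c + 1 = a + (1 - c) by ring.
  have -> : b - c + 1 = b + (1 - c) by ring.
  have -> : 2 - c = c + 2 * (1 - c) by ring.
  apply: hyp_sol_hyp2F1 => [|m]; first by ring.
  have -> : c + 2 * (1 - c) + m%:R = (m%:Z + 2)%:~R - c
    by rewrite rmorphD /=; ring.
  exact: ncn0.
have z2_sol : hyp_sol (c + 2) (- a) (- b - 2) (- c - 1) z2.
  rewrite /z2.
  have -> : - a + c + 2 = - a + (c + 2) by ring.
  have -> : - b + c = - b - 2 + (c + 2) by ring.
  have -> : 3 + c = - c - 1 + 2 * (c + 2) by ring.
  apply: hyp_sol_hyp2F1 => [|m]; first by ring.
  have -> : - c - 1 + 2 * (c + 2) + m%:R = c + (m%:Z + 3)%:~R
    by rewrite rmorphD /=; ring.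
  exact: cn0.
have w1_exp : theta (1 : fps K) = (0 + 0) *: 1 by rewrite theta1 addr0 scale0r.
have w2_exp : theta (k *: fpsX ^+ 3) = (1 - c + (c + 2)) *: (k *: fpsX ^+ 3).
  rewrite thetaZ thetaXn !scalerA; congr (_ *: _); ring.
have sys := bilinear_systemD (bilinear_system_sol y1_sol z1_sol w1_exp)
                         (bilinear_system_sol y2_sol z2_sol w2_exp).
have := bilinear_system_quadratic cNint sys.
rewrite !mul1r -!scalerAl; apply.
- by rewrite fcoefD fcoefZ -mulrA fcoefXnM fcoefM0 !hyp2F1_0 mulr0 addr0 mulr1.
- by rewrite fcoefD fcoefZ -mulrA fcoefXnM fcoefM0 fcoef_twist
    !addr0 !(mulr0, mul0r, addr0).
- by rewrite fcoefD fcoefZ -mulrA fcoefXnM fcoefM0 fcoef_twist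
    !addr0 !(mulr0, mul0r, addr0).
(* The coefficient of [t^3] in [T] is where the value of [k] matters. *)
have [y10 z10] : fcoef (twist 0 y1) 0 = 0 /\ fcoef (twist 0 z1) 0 = 0.
  by rewrite !fcoef_twist !addr0 !mul0r.
rewrite fcoefD !fcoef1BXMS !fcoefZ -mulrA !fcoefXnM ltnn subnn mulr0 subr0.
rewrite fcoefM0 fcoefM3 // fcoefM2 // !fcoef_twist.
rewrite !hyp2F1_0 !hyp2F1_1 !hyp2F1_2 /k !pochSr !poch0.
have c0 : c != 0 by have := cn0 0; rewrite addr0.
have c1 : c + 1 != 0 by have := cn0 1.
have c2 : c + 2 != 0 by have := cn0 2.
have cN1 : c - 1 != 0 by have := cn0 (-1).
have cN1' : - c - 1 != 0 by have := ncn0 (-1); rewrite addrC.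
by field; rewrite c1 c0 c2 cN1 cN1' subrK oppr_eq0.
Qed.

End Hypergeometric.

Local Open Scope complex_scope.

Theorem lemma3p7 (R : realType) (a b c : R[i])
    (hc : forall m : int, c <> m%:~R) :
  hyp2F1 a b c * hyp2F1 (- a) (- b - 2) (- c)
  + (a * b / (c * (c - 1))) *:
      (fpsX * hyp2F1 (a + 1) (b + 1) (c + 1) * hyp2F1 (- a) (- b - 2) (- c))
  + (a * poch b 3 * poch (a - c) 2 / (poch (c - 2) 3 * poch (c - 1) 3)) *:
      (fpsX ^+ 3 * hyp2F1 (a - c + 2) (b - c + 2) (3 - c)
                 * hyp2F1 (- a + c + 1) (- b + c - 1) (2 + c))
  = 1 + (a * (b - 2 * c + 2) / (c * (c - 1))) *: fpsX
      + (a * (a - b - 1) / (c * (c - 1))) *: fpsX ^+ 2.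
Proof.
have cn1 (m : int) : c - 1 + m%:~R != 0.
  apply/eqP => e; apply: (hc (1 - m)); apply: (eq_from_sub e).
  by rewrite rmorphB /=; ring.
have c1 (m : int) : c - 1 <> m%:~R.
  by move=> e; have := cn1 (- m); rewrite e rmorphN /= subrr eqxx.
have := hyp2F1_bilinear a b c1.
rewrite -hyp2F1_contig => [|m]; last exact: (cn1 m).
(* What remains is to substitute [c - 1] for [c] in the parameters. *)
rewrite mulrDl -scalerAl.
have -> : - (c - 1) - 1 = - c by ring.
have -> : a - (c - 1) - 1 = a - c by ring.
have -> : c - 1 - 1 = c - 2 by ring.
have -> : a - (c - 1) + 1 = a - c + 2 by ring.
have -> : b - (c - 1) + 1 = b - c + 2 by ring.
have -> : 2 - (c - 1) = 3 - c by ring.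
have -> : - a + (c - 1) + 2 = - a + c + 1 by ring.
have -> : - b + (c - 1) = - b + c - 1 by ring.
have -> : 3 + (c - 1) = 2 + c by ring.
have -> : b - 2 * (c - 1) = b - 2 * c + 2 by ring.
by rewrite subrK [(c - 1) * c]mulrC.
Qed.
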